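(* Consider the problem of minimizing $F(x)=\frac{f(x)+h(x)}{g(x)}$ over $x\in\mathbb{R}^n$, with $f,h,g$ as in the context and $g$ convex (not necessarily differentiable), and let $\theta\ge 0$ be a constant. Assume that $\tilde g=-g$ is locally $\rho$-bounded non-convex with $\rho<+\infty$ at every FCW-point and at every PCW-point. Then $$\{\text{global minimizers of }F\}\subseteq\{\text{FCW-points}\}=\{\text{PCW-points}\}\subseteq\{\text{D-points}\}\subseteq\{\text{C-points}\}.$$
   Context: Standing assumptions. $F(x)=\frac{f(x)+h(x)}{g(x)}$ takes only finite values on $\mathbb{R}^n$, with $f(x)+h(x)\ge 0$ and $g(x)>0$ for all $x$. The function $f$ is convex and differentiable, and there is $c\in\mathbb{R}^n$ with $c_i\ge 0$ such that $f(x+\eta e_i)\le f(x)+\nabla_i f(x)\eta+\frac{c_i}{2}\eta^2$ for all $x\in\mathbb{R}^n$, $\eta\in\mathbb{R}$, $i=1,\dots,n$ ($e_i$ is the $i$-th standard basis vector). The function $h$ is convex and separable: $h(x)=\sum_{i=1}^n h_i(x_i)$. Here $g$ is convex. Locally bounded non-convexity. $\tilde g=-g$ is locally $\rho$-bounded non-convex at a point $x$ if for all $y\in\mathbb{R}^n$, $\tilde g(x)\le \tilde g(y)+\langle v,x-y\rangle+\frac{\rho}{2}\|x-y\|_2^2$, where $v\in\partial\tilde g(x)$ is a (limiting) subgradient of $\tilde g$ at $x$. Let $\mathcal{J}_i(x,\eta)=f(x)+\nabla_i f(x)\eta+\frac{c_i+\theta}{2}\eta^2+h(x+\eta e_i)$,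 $\mathcal{K}_i(x,\eta)=\frac{\mathcal{J}_i(x,\eta)}{g(x+\eta e_i)}$, and $\mathcal{M}_i(x,\eta)=\mathcal{J}_i(x,\eta)-F(x)\,g(x+\eta e_i)$. FCW-point (for the given $\theta$): a point $x$ with $\mathcal{K}_i(x,0)=\min_{\eta\in\mathbb{R}}\mathcal{K}_i(x,\eta)$ for all $i=1,\dots,n$. PCW-point (for the given $\theta$): a point $x$ with $\mathcal{M}_i(x,0)=\min_{\eta\in\mathbb{R}}\mathcal{M}_i(x,\eta)$ for all $i=1,\dots,n$. D-point (directional point): a point $x$ with $F'(x;y-x)\ge 0$ for all $y\in\mathrm{dom}(F)$, where $F'(x;v)=\lim_{t\to 0^+}\frac{F(x+tv)-F(x)}{t}$ and $\mathrm{dom}(F)=\{x:|F(x)|<+\infty\}$. C-point (critical point): a point $x$ with $0\in\nabla f(x)+\partial h(x)-F(x)\,\partial g(x)$, where $\partial$ is the convex subdifferential. *)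

(* Defs.v *)
From HB Require Import structures.
From mathcomp Require Import all_boot all_order all_algebra.
From mathcomp Require Import all_classical all_reals all_analysis.

Set Implicit Arguments.
Unset Strict Implicit.
Unset Printing Implicit Defensive.

Import Order.TTheory GRing.Theory Num.Theory.
Import numFieldNormedType.Exports.

Local Open Scope classical_set_scope.
Local Open Scope ring_scope.

Section Vectors.
Context {R : realType} {n : nat}.
Implicit Types (phi : 'rV[R]_n -> R) (u v x y : 'rV[R]_n).

Definition basis_vec (i : 'I_n) : 'rV[R]_n := delta_mx 0 i.

Definition dot u v : R := \sum_i u 0 i * v 0 i.

(* The norm [`|x|] of the normed module ['rV[R]_n] is the sup norm, so the
   Euclidean norm has to be introduced separately. *)
Definition norm2 u : R := Num.sqrt (dot u u).

Definition gradient phi x : 'rV[R]_n := \row_i 'D_(basis_vec i) phi x.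

Definition convex_subdiff phi x : set 'rV[R]_n :=
  [set v | forall y, phi x + dot v (y - x) <= phi y].

Definition frechet_subdiff phi x : set 'rV[R]_n :=
  [set v | (0 <= limf_einf
      (fun y => ((phi y - phi x - dot v (y - x)) / norm2 (y - x))%:E)
      x^')%E].

Definition limiting_subdiff phi x : set 'rV[R]_n :=
  [set v | exists xs vs : nat -> 'rV[R]_n,
    [/\ xs @ \oo --> x,
        phi \o xs @ \oo --> phi x,
        forall k, frechet_subdiff phi (xs k) (vs k)
      & vs @ \oo --> v]].

Definition locally_bounded_nonconvex phi (rho : R) x : Prop :=
  exists2 v, limiting_subdiff phi x v &
    forall y, phi x <= phi y + dot v (x - y) + rho / 2 * norm2 (x - y) ^+ 2.

Definition diff_quotient phi x v (t : R) : R := (phi (x + t *: v) - phi x) / t.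

Definition dir_deriv phi x v : R := lim (diff_quotient phi x v @ 0^'+).

End Vectors.

Section FractionalProgram.
Context {R : realType} {n : nat}.
Variables (f h g : 'rV[R]_n -> R).
Implicit Types (x y : 'rV[R]_n) (i : 'I_n) (eta theta : R) (c : 'rV[R]_n).

Definition objF x : R := (f x + h x) / g x.

Definition model_J c theta i x eta : R :=
  f x + gradient f x 0 i * eta + (c 0 i + theta) / 2 * eta ^+ 2
  + h (x + eta *: basis_vec i).

Definition model_K c theta i x eta : R :=
  model_J c theta i x eta / g (x + eta *: basis_vec i).

Definition model_M c theta i x eta : R :=
  model_J c theta i x eta - objF x * g (x + eta *: basis_vec i).

Definition global_minimizers : set 'rV[R]_n :=
  [set x | forall y, objF x <= objF y].

Definition FCW_points c theta : set 'rV[R]_n :=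
  [set x | forall i eta, model_K c theta i x 0 <= model_K c theta i x eta].

Definition PCW_points c theta : set 'rV[R]_n :=
  [set x | forall i eta, model_M c theta i x 0 <= model_M c theta i x eta].

(* [objF] is real-valued, so its domain is the whole space.  The [cvg] part
   is needed because [lim] returns a default value when there is no limit. *)
Definition D_points : set 'rV[R]_n :=
  [set x | forall y, cvg (diff_quotient objF x (y - x) @ 0^'+) /\
                     0 <= dir_deriv objF x (y - x)].

Definition C_points : set 'rV[R]_n :=
  [set x | exists u w, [/\ convex_subdiff h x u, convex_subdiff g x w
                         & 0 = gradient f x + u - objF x *: w]].

End FractionalProgram.

(* Main.v *)
(* At an FCW- or PCW-point the minimal value of the model is F(x), resp. 0, and
   multiplying by g > 0 exchanges the two conditions.  The bounded non-convexity
   of -g gives a quadratic upper model of the convex function g, so g is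
   differentiable at a PCW-point, with gradient w say.  Coordinatewise
   optimality then makes F(x) w - grad f(x) a subgradient of the separable
   function h, that is F'(x; d) >= 0.  At a D-point g need not be differentiable,
   but any subgradient w of g at x (Hahn-Banach) makes F(x) w - grad f(x) a
   subgradient of h, because F(x) >= 0. *)
Require Import Defs.
From HB Require Import structures.
From mathcomp Require Import all_boot all_order all_algebra.
From mathcomp Require Import all_classical all_reals all_analysis.
From mathcomp Require Import ring lra.

Import Order.TTheory GRing.Theory Num.Theory.
Import numFieldNormedType.Exports.

Local Open Scope classical_set_scope.
Local Open Scope ring_scope.

(** * Bilinearity of the inner product and coordinates *)

Section Dot.
Context {R : realType} {n : nat}.
Implicit Types (u v w d : 'rV[R]_n) (a : R).

Lemma dotDl u v w : dot (u + v) w = dot u w + dot v w.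
Proof. by rewrite -big_split; apply: eq_bigr => i _; rewrite mxE mulrDl. Qed.

Lemma dotDr u v w : dot u (v + w) = dot u v + dot u w.
Proof. by rewrite -big_split; apply: eq_bigr => i _; rewrite mxE mulrDr. Qed.

Lemma dotZl a u w : dot (a *: u) w = a * dot u w.
Proof. by rewrite /dot mulr_sumr; apply: eq_bigr => i _; rewrite mxE mulrA. Qed.

Lemma dotZr a u w : dot u (a *: w) = a * dot u w.
Proof. by rewrite /dot mulr_sumr; apply: eq_bigr => i _; rewrite mxE mulrCA. Qed.

Lemma dotNl u w : dot (- u) w = - dot u w.
Proof. by rewrite -scaleN1r dotZl mulN1r. Qed.

Lemma dotNr u w : dot u (- w) = - dot u w.
Proof. by rewrite -scaleN1r dotZr mulN1r. Qed.

Lemma basis_vecE (i j : 'I_n) : basis_vec i 0 j = (j == i)%:R :> R.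
Proof. by rewrite mxE eqxx. Qed.

Lemma dot_basis_vecr u i : dot u (basis_vec i) = u 0 i.
Proof.
rewrite /dot (bigD1 i)//= basis_vecE eqxx mulr1 big1 ?addr0// => j /negPf ji.
by rewrite basis_vecE ji mulr0.
Qed.

Lemma dot_basis_vecl u i : dot (basis_vec i) u = u 0 i.
Proof.
by rewrite -dot_basis_vecr; apply: eq_bigr => j _; rewrite mulrC.
Qed.

Lemma sqr_norm2 u : norm2 u ^+ 2 = dot u u.
Proof. by rewrite sqr_sqrtr// sumr_ge0// => i _; rewrite -expr2 sqr_ge0. Qed.

End Dot.

(** Dividing by [t] and letting [t] tend to 0 removes the quadratic term. This turns optimality of a
    model with a quadratic term into a first-order inequality. *)
Lemma le_of_le_quadratic {R : realFieldType} (a b C : R) :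
  (forall t, 0 < t -> t <= 1 -> a * t <= b * t + C * t ^+ 2) -> a <= b.
Proof.
move=> H; have [//|ba] := leP a b.
(* If [b < a], this [t] gives [C * t < (a - b) / 2], which contradicts [a - b <= C * t]; the [+ 1]
   keeps the denominator positive when [C = 0]. *)
pose t := Num.min 1 ((a - b) / (2 * (`|C| + 1))).
have C1 : 0 < `|C| + 1 by rewrite ltr_wpDl.
have t0 : 0 < t by rewrite lt_min ltr01 divr_gt0 ?mulr_gt0 ?subr_gt0.
have t1 : t <= 1 by rewrite ge_min lexx.
have tab : t * (2 * (`|C| + 1)) <= a - b.
  by rewrite -ler_pdivlMr ?mulr_gt0// ge_min lexx orbT.
have {}H : a <= b + C * t.
  by rewrite -(ler_pM2r t0) mulrDl -mulrA -expr2 H.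
have : C * t <= `|C| * t by rewrite ler_pM2r// ler_norm.
nra.
Qed.

(** * Convex functions along rays and existence of subgradients *)

Section Convex.
Context {R : realType} {n : nat}.
Variable phi : 'rV[R]_n -> R.
Hypothesis phi_convex : convex_function [set: 'rV[R]_n] phi.
Implicit Types (x d : 'rV[R]_n) (t : R).

Lemma convex_functionE t x y : 0 <= t <= 1 ->
  phi (t *: x + (1 - t) *: y) <= t * phi x + (1 - t) * phi y.
Proof.
move=> /andP[t0 t1].
by apply: (phi_convex (Itv01 t0 t1)); rewrite in_setT.
Qed.

Lemma convex_chord t x d : 0 <= t <= 1 ->
  phi (x + t *: d) - phi x <= t * (phi (x + d) - phi x).
Proof.
move=> /(convex_functionE _ (x + d) x) H; move: H.
rewrite (_ : _ + (1 - t) *: x = x + t *: d); first lra.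
by rewrite scalerDr scalerBl scale1r addrC addrA subrK.
Qed.

Lemma convex_midpoint x d : 2 * phi x <= phi (x + d) + phi (x - d).
Proof.
have half01 : 0 <= (2^-1 : R) <= 1.
  by rewrite invr_ge0 ler0n invf_le1 ?ltr0n ?ler1n.
have := convex_functionE _ (x + d) (x - d) half01.
rewrite (_ : 1 - 2^-1 = 2^-1 :> R); last by lra.
rewrite -scalerDr addrACA subrr addr0 -mulr2n -(scaler_nat 2 x) scalerA.
rewrite mulVf ?pnatr_eq0// scale1r; lra.
Qed.

Lemma diff_quotient_nondecreasing x d s t : 0 < s -> s <= t ->
  diff_quotient phi x d s <= diff_quotient phi x d t.
Proof.
move=> s0 st; have t0 : 0 < t by apply: lt_le_trans st.
rewrite /diff_quotient ler_pdivrMr// mulrAC -mulrA mulrC.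
(* The point [x + s *: d] lies on the chord from [x] to [x + t *: d], at parameter [s / t]. *)
have /(convex_chord _ x (t *: d)) : 0 <= s / t <= 1.
  by rewrite divr_ge0 ?(ltW s0) ?(ltW t0)//= ler_pdivrMr// mul1r.
by rewrite scalerA divfK ?gt_eqF.
Qed.

Lemma diff_quotient_le x d t : 0 < t <= 1 ->
  diff_quotient phi x d t <= phi (x + d) - phi x.
Proof.
move=> /andP[t0 t1]; rewrite ler_pdivrMr// mulrC.
by apply: convex_chord; rewrite ltW.
Qed.

(** The quotient decreases as [t] decreases to 0, so a lower bound is enough for a right limit at
    0. *)
Lemma is_cvg_diff_quotient x d (b : R) :
  (forall t, 0 < t -> b <= diff_quotient phi x d t) ->
  cvg (diff_quotient phi x d @ 0^'+).
Proof.
move=> lb; apply: nondecreasing_at_right_is_cvgr.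
  near=> r => s t; rewrite !in_itv/= => /andP[s0 _] _.
  exact: diff_quotient_nondecreasing.
near=> r; exists b => _ [t t0r <-]; move: t0r; rewrite /= in_itv/= => /andP[t0 _].
exact: lb.
Unshelve. all: by end_near. Qed.

(* One step of the Hahn-Banach extension: the slope [a] in the new coordinate
   is squeezed between the left and the right quotients. *)
Lemma subgradient_extend x (i : 'I_n) (V : set 'rV[R]_n) w :
  (forall a b d e, V d -> V e -> V (a *: d + b *: e)) ->
  (exists d, V d) ->
  (forall d, V d -> phi x + dot w d <= phi (x + d)) ->
  exists a, forall d r, V d ->
    phi x + dot w d + a * r <= phi (x + d + r *: basis_vec i).
Proof.
move=> Vlin [d0 Vd0] Hw; set e := basis_vec i.
pose psi d := phi (x + d) - phi x.
have key d d' s s' : V d -> V d' -> 0 < s -> 0 < s' ->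
    (dot w d - psi (d - s *: e)) / s <= (psi (d' + s' *: e) - dot w d') / s'.
  move=> Vd Vd' s0 s'0; have ss0 : 0 < s + s' by rewrite addr_gt0.
  have ssN : s + s' != 0 by rewrite gt_eqF.
  (* With this weight the components along [e] cancel, so the convex combination lies in [x + V],
     where the bound by [w] is available. *)
  set t := s' / (s + s').
  have tE : 1 - t = s / (s + s') by rewrite /t; field.
  have t01 : 0 <= t <= 1.
    by rewrite /t divr_ge0 ?(ltW s'0) ?(ltW ss0)//= ler_pdivrMr// mul1r lerDr ltW.
  have := convex_functionE _ (x + (d - s *: e)) (x + (d' + s' *: e)) t01.
  have -> : t *: (x + (d - s *: e)) + (1 - t) *: (x + (d' + s' *: e))
      = x + (t *: d + (1 - t) *: d').
    by apply/rowP => j; rewrite !mxE tE /t; field.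
  have := Hw _ (Vlin t (1 - t) _ _ Vd Vd'); rewrite dotDr !dotZr.
  rewrite ler_pdivrMr// [X in _ -> _ -> _ <= X]mulrAC ler_pdivlMr// /psi tE /t.
  move: (phi _) (phi _) (phi _) (phi _) (dot _ _) (dot _ _) => r1 r2 r3 p u v.
  move=> H1 /(le_trans H1); rewrite -(ler_pM2r ss0).
  have -> : (p + (s' / (s + s') * v + s / (s + s') * u)) * (s + s')
    = p * (s + s') + s' * v + s * u by field.
  have -> : (s' / (s + s') * r2 + s / (s + s') * r1) * (s + s')
    = s' * r2 + s * r1 by field.
  lra.
pose A : set R := [set r | exists d s, [/\ V d, 0 < s &
    r = (dot w d - psi (d - s *: e)) / s]].
have A0 : A !=set0.
  by exists ((dot w d0 - psi (d0 - 1 *: e)) / 1), d0, 1; split.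
have Aub d' s' : V d' -> 0 < s' -> ubound A ((psi (d' + s' *: e) - dot w d') / s').
  by move=> Vd' s'0 _ [d [s [Vd s0 ->]]]; apply: key.
exists (sup A) => d r Vd; case: (ltgtP r 0) => [r0|r0|->].
- have : (dot w d - psi (d - (- r) *: e)) / (- r) <= sup A.
    apply: ub_le_sup; last by exists d, (- r); split => //; rewrite oppr_gt0.
    by exists ((psi (d0 + 1 *: e) - dot w d0) / 1); apply: Aub.
  rewrite ler_pdivrMr ?oppr_gt0// scaleNr opprK /psi addrA; lra.
- have : sup A <= (psi (d + r *: e) - dot w d) / r.
    by apply: sup_le_ub => //; apply: Aub.
  rewrite ler_pdivlMr// /psi addrA; lra.
- by rewrite mulr0 scale0r !addr0; apply: Hw.
Qed.

(** Induction on the dimension: [V k] is the span of the first [k] basis vectors, from the zero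
    space at [k = 0] to the whole space at [k = n], and each step extends the linear minorant by one
    coordinate. *)
Lemma convex_subdiff_nonempty x : exists w, convex_subdiff phi x w.
Proof.
pose V k : set 'rV[R]_n := [set d | forall i : 'I_n, (k <= i)%N -> d 0 i = 0].
suff /(_ n (leqnn n)) [w Hw] : forall k, (k <= n)%N ->
    exists w, forall d, V k d -> phi x + dot w d <= phi (x + d).
  exists w => y; rewrite -{2}(subrKC x y); apply: Hw => i.
  by rewrite leqNgt ltn_ord.
elim=> [_|k IH kn].
  exists 0 => d Vd; have -> : d = 0 by apply/rowP => i; rewrite mxE Vd.
  by rewrite -(scale0r (0 : 'rV[R]_n)) dotZr mul0r scale0r !addr0.
have [w Hw] := IH (ltnW kn); pose i := Ordinal kn.
have [||a Ha] := @subgradient_extend x i (V k) w _ _ Hw.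
- by move=> a b d e Vd Ve j kj; rewrite !mxE Vd// Ve// !mulr0 addr0.
- by exists 0 => j _; rewrite mxE.
(* The new vector is [w] with its [i]-th coordinate replaced by the slope [a]. *)
exists (w + (a - w 0 i) *: basis_vec i) => d Vd.
pose d0 := d - d 0 i *: basis_vec i.
have Vd0 : V k d0.
  move=> j; rewrite leq_eqVlt => /orP[/eqP kj|kj].
    have -> : j = i by apply/val_inj.
    by rewrite !mxE !eqxx mulr1 subrr.
  rewrite !mxE (Vd j kj) (_ : (j == i) = false) ?andbF ?mulr0 ?subr0//.
  by apply/eqP => ji; move: kj; rewrite ji ltnn.
have := Ha d0 (d 0 i) Vd0; rewrite -[x + d0 + _]addrA /d0 subrK; apply: le_trans.
rewrite dotDl dotZl dot_basis_vecl dotDr dotNr dotZr dot_basis_vecr.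
by rewrite le_eqVlt; apply/orP; left; apply/eqP; ring.
Qed.

(** On [[0, 1]] the function is squeezed between two affine functions of [t] with value [phi x] at
    0: a subgradient bound below and the chord above. *)
Lemma convex_cvg_right x d : phi (x + t *: d) @[t --> 0^'+] --> phi x.
Proof.
have [w Hw] := convex_subdiff_nonempty x.
have t0 : t @[t --> (0:R)^'+] --> (0:R) by apply: cvg_at_right_filter; exact: cvg_id.
have lin (a b : R) : a + t * b @[t --> 0^'+] --> a.
  rewrite -[X in _ --> X]addr0 -[X in _ --> _ + X](mul0r b).
  by apply: cvgD; [exact: cvg_cst|apply: cvgM => //; exact: cvg_cst].
apply: (squeeze_cvgr _ (lin _ (dot w d)) (lin _ (phi (x + d) - phi x))).
near=> t; apply/andP; split.
  by have := Hw (x + t *: d); rewrite addrAC subrr add0r dotZr.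
rewrite -lerBlDl; apply: convex_chord; apply/andP; split; near: t.
  exact: nbhs_right_ge.
exact: nbhs_right_le.
Unshelve. all: by end_near. Qed.

End Convex.

(** Linearity of the differential expresses the derivative along [d] through the partial derivatives
    that define [gradient]; the two-sided limit is then restricted to the right. *)
Lemma differentiable_cvg_diff_quotient {R : realType} {n : nat}
    (f : 'rV[R]_n -> R) (x d : 'rV[R]_n) :
  differentiable f x ->
  diff_quotient f x d t @[t --> 0^'+] --> dot (gradient f x) d.
Proof.
move=> df.
have <- : 'D_d f x = dot (gradient f x) d.
  rewrite deriveE// [in LHS](row_sum_delta d) linear_sum; apply: eq_bigr => i _.
  by rewrite linearZ /= !mxE mulrC deriveE.
have /cvg_dnbhs_at_right : (t^-1 *: ((f \o shift x) (t *: d) - f x)) @[t --> 0^']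
    --> 'D_d f x by exact: diff_derivable.
apply: cvg_trans; apply: near_eq_cvg; near=> t.
by rewrite /diff_quotient /= [t *: d + x]addrC mulrC.
Unshelve. all: by end_near. Qed.

(** * The inclusions between the classes of points *)

Section FractionalProgram.
Context {R : realType} {n : nat}.
Variables (f h g : 'rV[R]_n -> R) (hs : 'I_n -> R -> R).
Variables (c : 'rV[R]_n) (theta : R).
Hypothesis num_ge0 : forall x, 0 <= f x + h x.
Hypothesis g_gt0 : forall x, 0 < g x.
Hypothesis f_diff : forall x, differentiable f x.
Hypothesis f_smooth : forall (x : 'rV[R]_n) (eta : R) (i : 'I_n),
  f (x + eta *: basis_vec i)
    <= f x + gradient f x 0 i * eta + c 0 i / 2 * eta ^+ 2.
Hypothesis h_convex : convex_function [set: 'rV[R]_n] h.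
Hypothesis h_separable : forall x, h x = \sum_i hs i (x 0 i).
Hypothesis g_convex : convex_function [set: 'rV[R]_n] g.
Hypothesis theta_ge0 : 0 <= theta.
Implicit Types (x d w : 'rV[R]_n).

Local Notation F := (objF f h g).

Lemma objF_ge0 x : 0 <= F x.
Proof. by rewrite divr_ge0// ltW. Qed.

Lemma objF_mul x : F x * g x = f x + h x.
Proof. by rewrite divfK// gt_eqF. Qed.

Lemma model_J0 i x : model_J f h c theta i x 0 = f x + h x.
Proof. by rewrite /model_J scale0r addr0 expr0n !mulr0 !addr0. Qed.

Lemma model_K0 i x : model_K f h g c theta i x 0 = F x.
Proof. by rewrite /model_K model_J0 scale0r addr0. Qed.

Lemma model_M0 i x : model_M f h g c theta i x 0 = 0.
Proof. by rewrite /model_M model_J0 scale0r addr0 objF_mul subrr. Qed.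

(** The numerator of the model majorizes [f + h] by the coordinatewise smoothness bound, to which
    [theta >= 0] only adds curvature. The majorant is tight at [eta = 0], so a global minimizer of
    [F] also minimizes the model. *)
Lemma objF_le_model_K i x eta :
  F (x + eta *: basis_vec i) <= model_K f h g c theta i x eta.
Proof.
rewrite /model_K ler_pM2r ?invr_gt0// lerD2r.
apply: (le_trans (f_smooth x eta i)).
by rewrite lerD2l ler_wpM2r ?sqr_ge0// ler_pM2r ?invr_gt0 ?ltr0n// lerDl.
Qed.

Lemma global_minimizers_FCW :
  global_minimizers f h g `<=` FCW_points f h g c theta.
Proof.
move=> x xmin i eta; rewrite model_K0.
exact: le_trans (xmin _) (objF_le_model_K i x eta).
Qed.

Lemma FCW_PCW : FCW_points f h g c theta = PCW_points f h g c theta.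
Proof.
by apply/seteqP; split=> x xP i eta; move: (xP i eta);
  rewrite model_K0 model_M0 /model_K /model_M subr_ge0 ler_pdivlMr.
Qed.

(* [w] is the opposite of the limiting subgradient of [-g].  Its subgradient
   inequality for [g] comes from the upper model at [- t *: d] and midpoint
   convexity; together the two bounds say that [w] is the gradient of [g]. *)
Lemma locally_bounded_nonconvex_convex rho x :
  locally_bounded_nonconvex (fun y => - g y) rho x ->
  exists w, forall d,
    dot w d <= g (x + d) - g x /\
    g (x + d) - g x <= dot w d + rho / 2 * dot d d.
Proof.
move=> [v _ Hv]; exists (- v).
have ub d : g (x + d) - g x <= dot (- v) d + rho / 2 * dot d d.
  have := Hv (x + d); rewrite opprD addrA subrr sub0r sqr_norm2.
  by rewrite !dotNr !dotNl opprK; lra.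
move=> d; split=> //; apply: (@le_of_le_quadratic _ _ _ (rho / 2 * dot d d)).
move=> t t0 t1.
have t01 : 0 <= t <= 1 by rewrite ltW.
have := convex_chord g g_convex t x d t01.
have := convex_midpoint g g_convex x (t *: d).
have := ub (- (t *: d)); rewrite !dotNr !dotNl !opprK !dotZr !dotZl.
by lra.
Qed.

(** A move along one basis vector changes a single summand of [h]. This is what lets coordinatewise
    inequalities add up to one in an arbitrary direction. *)
Lemma separable_coord_sum x d :
  \sum_i (h (x + d 0 i *: basis_vec i) - h x) = h (x + d) - h x.
Proof.
rewrite !h_separable -sumrB; apply: eq_bigr => i _.
rewrite h_separable -sumrB (bigD1 i)//= big1 ?addr0 => [|j /negPf ji].
  by rewrite !mxE !eqxx mulr1.
by rewrite !mxE ji andbF mulr0 addr0 subrr.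
Qed.

Lemma PCW_h_subgradient x w : PCW_points f h g c theta x ->
  (forall d, dot w d <= g (x + d) - g x) ->
  forall d, dot (F x *: w - gradient f x) d <= h (x + d) - h x.
Proof.
move=> xP Hw d; rewrite -separable_coord_sum; apply: ler_sum => i _.
set r := d 0 i; rewrite !mxE -/r.
(* Optimality is used at the step [t * r]: [g] is replaced by its linear minorant, allowed since
   [F x >= 0], and [h] by its chord. Only the term in [t ^+ 2] separates the result from the
   goal. *)
apply: (@le_of_le_quadratic _ _ _ ((c 0 i + theta) / 2 * r ^+ 2)) => t t0 t1.
have t01 : 0 <= t <= 1 by rewrite ltW.
have := convex_chord h h_convex t x (r *: basis_vec i) t01.
have := xP i (t * r); rewrite model_M0 /model_M /model_J !scalerA !mxE.
have := ler_wpM2l (objF_ge0 x) (Hw ((t * r) *: basis_vec i)).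
rewrite mulrBr objF_mul dotZr dot_basis_vecr.
by lra.
Qed.

(** Since [F x * g x = f x + h x], the increment of [F] is that of [f + h - F x * g] (with [F x]
    frozen) over the new denominator. *)
Lemma diff_quotient_objF x d t :
  diff_quotient F x d t =
  (diff_quotient f x d t + diff_quotient h x d t - F x * diff_quotient g x d t)
    / g (x + t *: d).
Proof.
rewrite /diff_quotient /objF.
(* Division by zero gives zero, so both sides vanish at [t = 0] and the identity can be rewritten
   under the limit without a side condition. *)
have [->|t0] := eqVneq t 0; first by rewrite invr0 !mulr0 addr0 subr0 mul0r.
by field; rewrite t0 !gt_eqF.
Qed.

Lemma PCW_D :
  (forall x, PCW_points f h g c theta x ->
    exists rho : R, locally_bounded_nonconvex (fun y => - g y) rho x) ->
  PCW_points f h g c theta `<=` D_points f h g.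
Proof.
move=> lbn x xP y; move: (y - x) => d.
have [rho /locally_bounded_nonconvex_convex[w Hw]] := lbn x xP.
have hsub := PCW_h_subgradient _ _ xP (fun d => (Hw d).1).
(* This bound on the slope of [h] is exactly what offsets the limits of the [f] and [g] terms in the
   numerator. *)
pose s := dot (F x *: w - gradient f x) d.
have hlb t : 0 < t -> s <= diff_quotient h x d t.
  by move=> t0; rewrite ler_pdivlMr// mulrC -dotZr.
have hcvg := is_cvg_diff_quotient h h_convex x d s hlb.
have hlim : s <= lim (diff_quotient h x d @ 0^'+).
  apply: limr_ge => //; near=> t; apply: hlb; near: t.
  exact: nbhs_right_gt.
have t0 : t @[t --> (0:R)^'+] --> (0:R).
  by apply: cvg_at_right_filter; exact: cvg_id.
(* The two bounds on [g (x + t *: d) - g x] differ by a multiple of [t ^+ 2], so after division by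
   [t] they have the same limit. *)
have gcvg : diff_quotient g x d t @[t --> 0^'+] --> dot w d.
  have ubcvg : dot w d + t * (rho / 2 * dot d d) @[t --> 0^'+] --> dot w d.
    rewrite -[X in _ --> X]addr0 -[X in _ --> _ + X](mul0r (rho / 2 * dot d d)).
    by apply: cvgD; [exact: cvg_cst|apply: cvgM => //; exact: cvg_cst].
  apply: (squeeze_cvgr _ (cvg_cst (dot w d)) ubcvg).
  near=> t; have tp : 0 < t by near: t; exact: nbhs_right_gt.
  have [lb ub] := Hw (t *: d); rewrite /diff_quotient /=.
  rewrite ler_pdivlMr// ler_pdivrMr//; move: lb ub; rewrite !dotZr dotZl.
  by move=> lb ub; apply/andP; split; lra.
have Fcvg : diff_quotient F x d t @[t --> 0^'+] -->
    (dot (gradient f x) d + lim (diff_quotient h x d @ 0^'+) - F x * dot w d) / g x.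
  under eq_fun do rewrite diff_quotient_objF.
  apply: cvgM; last first.
    by apply: cvgV; [rewrite gt_eqF|exact: (convex_cvg_right g g_convex)].
  apply: cvgB; last by apply: cvgM => //; exact: cvg_cst.
  by apply: cvgD => //; exact: differentiable_cvg_diff_quotient.
split; first by apply/cvg_ex; eexists; exact: Fcvg.
rewrite /dir_deriv (cvg_lim _ Fcvg)// divr_ge0 ?(ltW (g_gt0 x))//.
by move: hlim; rewrite /s dotDl dotZl dotNl; lra.
Unshelve. all: by end_near. Qed.

Lemma D_C : D_points f h g `<=` C_points f h g.
Proof.
move=> x xD; have [w Hw] := convex_subdiff_nonempty g g_convex x.
(* Once [w] is chosen, the critical-point equation forces this choice of the subgradient of [h]. *)
exists (F x *: w - gradient f x), w; split=> //; last first.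
  by rewrite addrCA subrr addr0 subrr.
move=> y; have [Fcvg Fge0] := xD y; rewrite -lerBrDl.
set d := y - x in Fcvg Fge0 *.
have -> : y = x + d by rewrite subrKC.
(* Multiplying by [g (x + t *: d)] clears the denominator. The quotient of [h] is then bounded above
   by its value at [t = 1] and that of [g] below by [dot w d], so among the three quotients only
   that of [f] is passed to the limit. *)
have lhs : diff_quotient F x d t * g (x + t *: d) @[t --> 0^'+] -->
    lim (diff_quotient F x d @ 0^'+) * g x.
  by apply: cvgM; [exact: Fcvg|exact: convex_cvg_right].
have rhs : diff_quotient f x d t + (h (x + d) - h x - F x * dot w d) @[t --> 0^'+]
    --> dot (gradient f x) d + (h (x + d) - h x - F x * dot w d).
  by apply: cvgD; [exact: differentiable_cvg_diff_quotient|exact: cvg_cst].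
have : lim (diff_quotient F x d @ 0^'+) * g x <=
    dot (gradient f x) d + (h (x + d) - h x - F x * dot w d).
  apply: ler_cvg_to lhs rhs _; near=> t.
  have tp : 0 < t by near: t; exact: nbhs_right_gt.
  have t1 : t <= 1 by near: t; exact: nbhs_right_le.
  rewrite /= diff_quotient_objF divfK ?gt_eqF// -addrA lerD2l lerB//.
    by apply: diff_quotient_le => //; rewrite tp.
  rewrite ler_wpM2l ?objF_ge0// ler_pdivlMr// mulrC -dotZr.
  by have := Hw (x + t *: d); rewrite addrAC subrr add0r; lra.
have : 0 <= lim (diff_quotient F x d @ 0^'+) * g x by rewrite mulr_ge0// ltW.
by rewrite dotDl dotZl dotNl; lra.
Unshelve. all: by end_near. Qed.

End FractionalProgram.

Theorem theorem5p10 (R : realType) (n : nat)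
  (f h g : 'rV[R]_n -> R) (hs : 'I_n -> R -> R) (c : 'rV[R]_n) (theta : R)
  (num_ge0 : forall x, 0 <= f x + h x)
  (g_gt0 : forall x, 0 < g x)
  (f_convex : convex_function [set: 'rV[R]_n] f)
  (f_diff : forall x, differentiable f x)
  (c_ge0 : forall i, 0 <= c 0 i)
  (f_smooth : forall (x : 'rV[R]_n) (eta : R) (i : 'I_n),
    f (x + eta *: basis_vec i)
      <= f x + gradient f x 0 i * eta + c 0 i / 2 * eta ^+ 2)
  (h_convex : convex_function [set: 'rV[R]_n] h)
  (h_separable : forall x, h x = \sum_i hs i (x 0 i))
  (g_convex : convex_function [set: 'rV[R]_n] g)
  (theta_ge0 : 0 <= theta)
  (g_lbn_FCW : forall x, FCW_points f h g c theta x ->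
    exists rho : R, locally_bounded_nonconvex (fun y => - g y) rho x)
  (g_lbn_PCW : forall x, PCW_points f h g c theta x ->
    exists rho : R, locally_bounded_nonconvex (fun y => - g y) rho x) :
  [/\ global_minimizers f h g `<=` FCW_points f h g c theta,
      FCW_points f h g c theta = PCW_points f h g c theta,
      PCW_points f h g c theta `<=` D_points f h g
    & D_points f h g `<=` C_points f h g].
Proof.
split.
- exact: global_minimizers_FCW.
- exact: FCW_PCW.
- exact: PCW_D.
- exact: D_C.
Qed.
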